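(* There are infinitely many planar $4$-connected essentially $6$-edge-connected $4$-regular simple graphs $G$ with $|E(G)|$ divisible by $3$ which admit no claw-decomposition.
   Context: A simple graph has no loops and no multiple edges. A graph is essentially $\lambda$-edge-connected if, for every edge cut of size strictly less than $\lambda$, all edges of the cut are incident with a common vertex. A claw is the star $K_{1,3}$; a claw-decomposition of $G$ is a partition of $E(G)$ into edge sets each of which induces a copy of $K_{1,3}$. *)

(* Defs.v *)
From HB Require Import structures.
From mathcomp Require Import all_boot all_order all_algebra.

Set Implicit Arguments.
Unset Strict Implicit.
Unset Printing Implicit Defensive.

Record sgraph := SGraph {
  vertex :> finType;
  adj : rel vertex;
  adj_sym : symmetric adj;
  adj_irrefl : irreflexive adj
}.

Definition isomorphic (G H : sgraph) : Prop :=
  exists2 f : G -> H, bijective f & forall x y, adj (f x) (f y) = adj x y.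

Definition edges (G : sgraph) : {set {set G}} :=
  [set e | [exists x : G, exists y : G, adj x y && (e == [set x; y])]].

Definition regular (k : nat) (G : sgraph) : Prop :=
  forall x : G, #|[set y | adj x y]| = k.

Definition induced_connected (G : sgraph) (A : {set G}) : Prop :=
  {in A &, forall x y, connect [rel u v in A | adj u v] x y}.

Definition vertex_connected (k : nat) (G : sgraph) : Prop :=
  k < #|G| /\ forall S : {set G}, #|S| < k -> induced_connected (~: S).

(* An edge cut is the set of all edges between X and its complement, for X a
   nonempty proper vertex set; a set of edges that merely contains such a set
   is not an edge cut. *)
Definition edge_cut (G : sgraph) (X : {set G}) : {set {set G}} :=
  [set e in edges G | (e :&: X != set0) && (e :\: X != set0)].

Definition essentially_edge_connected (k : nat) (G : sgraph) : Prop :=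
  forall X : {set G}, X != set0 -> X != setT -> #|edge_cut X| < k ->
  exists v : G, {in edge_cut X, forall e : {set G}, v \in e}.

Definition is_claw (G : sgraph) (D : {set {set G}}) : Prop :=
  exists (c : G) (L : {set G}),
    [/\ c \notin L, #|L| = 3 & D = [set [set c; x] | x in L]].

Definition claw_decomposition (G : sgraph) (P : {set {set {set G}}}) : Prop :=
  partition P (edges G) /\ {in P, forall D, is_claw D}.

(* Required only here, because classical_sets rebinds set0, setT and partition,
   which above denote the notions of finset. *)
From mathcomp Require Import all_classical all_reals all_analysis.
Import Order.TTheory GRing.Theory Num.Theory.
Import numFieldNormedType.Exports.
Local Open Scope classical_set_scope.
Local Open Scope ring_scope.

(* Each edge e is drawn as a simple arc parametrized by [0, 1]; the direction
   of the parametrization is arbitrary. *)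
Definition plane_drawing (R : realType) (G : sgraph)
    (pos : G -> R * R) (arc : {set G} -> R -> R * R) : Prop :=
  [/\ injective pos,
      {in edges G, forall e, [/\
        {within `[0, 1], continuous (arc e)},
        {in `[0, 1] &, injective (arc e)} &
        exists x y : G,
          [/\ e = [set x; y]%SET, arc e 0 = pos x & arc e 1 = pos y]]},
      {in edges G, forall e (z : G), ~ (arc e @` `]0, 1[) (pos z)} &
      {in edges G &, forall e f, e != f ->
        arc e @` `]0, 1[ `&` arc f @` `[0, 1] = set0}].

Definition planar (R : realType) (G : sgraph) : Prop :=
  exists (pos : G -> R * R) (arc : {set G} -> R -> R * R),
    plane_drawing pos arc.

(* Main.v *)
Require Import Defs.
From Stdlib Require Import ZArith.
From mathcomp Require Import all_boot all_order all_algebra.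
From mathcomp Require Import zify ssrZ ring lra.

(* In a 4-regular graph a claw decomposition has 2n/3 claws, hence at most 2n/3
   centres, and every edge contains a centre; so at least n/3 vertices form an
   independent set. The graphs below are rings made of three copies of a planar
   gadget on 13 vertices with independence number 4 < 13/3, closed up by an
   arbitrarily long strip of triangles (the square of a path), so that their
   independence number is less than n/3.

   Small vertex cuts and small edge cuts are both excluded by a transfer-matrix
   argument: a separation is a labelling of the vertices by "left", "right" and
   "removed", whose cost counts removed vertices and left-right edges. The
   vertices are scanned one by one, remembering only the labels of the vertices
   which still have neighbours to come. The set of states reachable within the
   budget is finite and is invariant along the strip.

   The drawing is a straight-line drawing in which the strip fills a fixed
   rectangle and all other vertices have fixed integer coordinates; two edges do
   not cross because an affine functional separates them. *)

Set Implicit Arguments.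
Unset Strict Implicit.
Unset Printing Implicit Defensive.

(** * The graphs *)

Definition gadget : seq (nat * nat) :=
  [:: (0, 1); (0, 3); (0, 4); (1, 2); (1, 3); (2, 5); (2, 6); (3, 4); (3, 5);
      (4, 5); (4, 7); (5, 6); (6, 8); (6, 9); (7, 8); (7, 10); (7, 11);
      (8, 9); (8, 10); (9, 12); (10, 11); (10, 12); (11, 12)].

(** Inside the gadget exactly the vertices 0, 1, 2, 9, 11 and 12 have degree 3. A link to the
    neighbouring copy, or an edge to the strip, supplies the fourth neighbour. *)
Definition link : seq (nat * nat) := [:: (9, 2); (12, 1); (11, 0)].

Definition hub (i j : nat) : bool :=
  if i %/ 13 == j %/ 13 then (i %% 13, j %% 13) \in gadget
  else (j %/ 13 == (i %/ 13).+1) && ((i %% 13, j %% 13) \in link).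

(* Adjacency for [i < j]. Vertex [13 * c + v] with [c < 3] is vertex [v] of the
   [c]-th copy of the gadget; the strip consists of the vertices [39, ..., n - 1]. *)
Definition fwd (n i j : nat) : bool :=
  if j < 39 then hub i j
  else if 39 <= i then j <= i.+2
  else [|| (j == 39) && (i \in [:: 37; 38]), (j == 40) && (i == 35),
           (j == n.-1) && (i \in [:: 1; 2]) | (j == n.-2) && (i == 0)].

Definition ring_adj (n i j : nat) : bool :=
  (i < j) && fwd n i j || (j < i) && fwd n j i.

Lemma ring_adj_sym n : symmetric (ring_adj n).
Proof. by move=> i j; rewrite /ring_adj orbC. Qed.

Lemma ring_adj_irrefl n : irreflexive (ring_adj n).
Proof. by move=> i; rewrite /ring_adj ltnn. Qed.

Lemma ring_adj_lt n i j : i < j -> ring_adj n i j = fwd n i j.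
Proof. by move=> ij; rewrite /ring_adj ij ltnNge ltnW //= orbF. Qed.

(* The length [6 * m + 6] of the strip is divisible by 3, so that the strip splits
   into triangles, and even, because the ring would be twisted otherwise. *)
Definition ring_order (m : nat) : nat := 6 * m + 45.

Definition ring_graph (m : nat) : sgraph :=
  @SGraph 'I_(ring_order m) (fun i j => ring_adj (ring_order m) i j)
    (fun i j => ring_adj_sym (ring_order m) i j) (fun i => ring_adj_irrefl (ring_order m) i).

Lemma card_set_ord_count n (P : pred nat) : #|[set y : 'I_n | P y]| = count P (iota 0 n).
Proof. by rewrite cardsE cardE /enum_mem size_filter -val_enum_ord count_map enumT. Qed.

Lemma count_uniq_list n (P : pred nat) (l : seq nat) :
  uniq l -> (forall j, (j < n) && P j = (j \in l)) -> count P (iota 0 n) = size l.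
Proof.
move=> ul memP; rewrite -size_filter; apply/perm_size/uniq_perm => //.
  by rewrite filter_uniq ?iota_uniq.
by move=> j; rewrite mem_filter mem_iota /= add0n andbC memP.
Qed.

Definition hub_adj (i j : nat) := (i < j) && hub i j || (j < i) && hub j i.

Lemma ring_adj_hub n i j : i < 39 -> j < 39 -> ring_adj n i j = hub_adj i j.
Proof. by move=> i39 j39; rewrite /ring_adj /fwd i39 j39. Qed.

Lemma ring_adj_strip n i j :
  39 <= i -> 39 <= j -> ring_adj n i j = [&& i != j, j <= i + 2 & i <= j + 2].
Proof.
move=> i39 j39; rewrite /ring_adj /fwd i39 j39 !(ltnNge _ 39) i39 j39 /=.
by lia.
Qed.

Lemma ring_adj_link n i j : i < 39 -> 39 <= j ->
  ring_adj n i j = [|| (j == 39) && (i \in [:: 37; 38]), (j == 40) && (i == 35),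
                       (j == n.-1) && (i \in [:: 1; 2]) | (j == n.-2) && (i == 0)].
Proof.
move=> i39 j39; rewrite ring_adj_lt ?(leq_trans i39) //.
by rewrite /fwd (ltnNge j 39) j39 /= (leqNgt 39) i39.
Qed.

(** * Explicit neighbour lists and regularity *)

Definition hub_nbrs (x : nat) : seq nat := [seq j <- iota 0 39 | hub_adj x j].

Definition ring_nbrs (n x : nat) : seq nat :=
  if x < 39 then
    hub_nbrs x ++
    (if x \in [:: 37; 38] then [:: 39] else if x == 35 then [:: 40] else
     if x \in [:: 1; 2] then [:: n.-1] else if x == 0 then [:: n.-2] else [::])
  else if x == 39 then [:: 37; 38; 40; 41]
  else if x == 40 then [:: 35; 39; 41; 42]
  else if x == n.-1 then [:: 1; 2; n - 3; n - 2]
  else if x == n.-2 then [:: 0; n - 4; n - 3; n - 1]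
  else [:: x - 2; x - 1; x + 1; x + 2].

Lemma mem_hub_nbrs x j : (j \in hub_nbrs x) = (j < 39) && hub_adj x j.
Proof. by rewrite mem_filter mem_iota andbC. Qed.

Lemma size_ring_nbrs n x : size (ring_nbrs n x) = 4.
Proof.
rewrite /ring_nbrs; have [x39|_] := ltnP x 39; last by do !case: ifP.
rewrite size_cat.
(* By computation, each hub vertex has four neighbours in the hub, except for the six vertices
   attached to the strip, which have three. *)
have /allP/(_ x) : all (fun x => size (hub_nbrs x) +
   [|| x \in [:: 37; 38], x == 35, x \in [:: 1; 2] | x == 0] == 4) (iota 0 39).
  by vm_compute.
rewrite mem_iota x39 => /(_ isT) /eqP; apply: etrans; congr (_ + _).
by case: (x \in [:: 37; 38]); case: (x == 35); case: (x \in [:: 1; 2]); case: (x == 0).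
Qed.

Lemma uniq_ring_nbrs n x : 45 <= n -> uniq (ring_nbrs n x).
Proof.
move=> n45; rewrite /ring_nbrs; have [x39|x39] := ltnP x 39; last first.
  case: eqP => [//|_]; case: eqP => [//|_].
  case: eqP => [_|_]; first by rewrite /= !inE; lia.
  case: eqP => [_|_]; first by rewrite /= !inE; lia.
  by rewrite /= !inE; lia.
rewrite cat_uniq; apply/and3P; split; last by do !case: ifP.
  by rewrite filter_uniq ?iota_uniq.
apply/hasPn => j jl; rewrite mem_hub_nbrs.
suff j39 : 39 <= j by rewrite (ltnNge j 39) j39.
move: jl; case: ifP => _; first by rewrite inE => /eqP->.
case: ifP => _; first by rewrite inE => /eqP->.
case: ifP => _; first by rewrite inE => /eqP->; lia.
by case: ifP => _; first by rewrite inE => /eqP->; lia.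
Qed.

Lemma mem_ring_nbrs n x j : 45 <= n -> x < n ->
  (j < n) && ring_adj n x j = (j \in ring_nbrs n x).
Proof.
move=> n45 xn; rewrite /ring_nbrs.
have [x39|x39] := ltnP x 39; have [j39|j39] := ltnP j 39.
- rewrite ring_adj_hub // mem_cat mem_hub_nbrs j39 /=.
  rewrite (_ : j < n); last by lia.
  rewrite orb_idr // => jl; exfalso; move: jl.
  case: ifP => _; first by rewrite inE => /eqP; lia.
  case: ifP => _; first by rewrite inE => /eqP; lia.
  case: ifP => _; first by rewrite inE => /eqP; lia.
  by case: ifP => _; first by rewrite inE => /eqP; lia.
- rewrite ring_adj_link // mem_cat mem_hub_nbrs (ltnNge j 39) j39 /=.
  rewrite !inE.
  case: ifP => [h|h]; first by rewrite inE; lia.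
  case: ifP => [h1|h1]; first by rewrite inE; lia.
  case: ifP => [h2|h2]; first by rewrite inE; lia.
  by case: ifP => [h3|h3]; rewrite ?inE ?in_nil; lia.
- rewrite ring_adj_sym ring_adj_link // !inE.
  case: (altP (x =P 39)) => [e|h]; first by rewrite ?inE; lia.
  case: (altP (x =P 40)) => [e|h1]; first by rewrite ?inE; lia.
  case: (altP (x =P n.-1)) => [e|h2]; first by rewrite ?inE; lia.
  case: (altP (x =P n.-2)) => [e|h3]; first by rewrite ?inE; lia.
  by rewrite ?inE; lia.
- rewrite ring_adj_strip //.
  case: (altP (x =P 39)) => [e|h]; first by rewrite ?inE; lia.
  case: (altP (x =P 40)) => [e|h1]; first by rewrite ?inE; lia.
  case: (altP (x =P n.-1)) => [e|h2]; first by rewrite ?inE; lia.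
  case: (altP (x =P n.-2)) => [e|h3]; first by rewrite ?inE; lia.
  by rewrite ?inE; lia.
Qed.

Lemma ring_graph_regular m : regular 4 (ring_graph m).
Proof.
have n45 : 45 <= ring_order m by rewrite leq_addl.
move=> x; rewrite (@card_set_ord_count (ring_order m) (ring_adj (ring_order m) x)).
rewrite -[RHS](size_ring_nbrs (ring_order m) x); apply: count_uniq_list.
  exact: uniq_ring_nbrs.
by move=> j; rewrite mem_ring_nbrs.
Qed.

(** * Labellings of low cost *)

(* A vertex labelled [None] is removed; [Some true] and [Some false] are the two sides. *)
Definition conflict (x y : option bool) : bool :=
  if (x, y) is (Some a, Some b) then a != b else false.

(* Labels of the frontier, cost so far, and the sizes of the two sides truncated
   at [cap]. *)
Definition state : Type := (seq (option bool) * nat * (nat * nat))%type.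

Definition labels : seq (option bool) := [:: None; Some true; Some false].

Definition start : seq state := [:: ([::], 0, (0, 0))].

Lemma fwd_link n j i : j < 39 -> 39 <= i ->
  fwd n j i = [|| (i == 39) && (j \in [:: 37; 38]), (i == 40) && (j == 35),
                  (i == n.-1) && (j \in [:: 1; 2]) | (i == n.-2) && (j == 0)].
Proof. by move=> j39 i39; rewrite /fwd (ltnNge i) i39 /= leqNgt j39. Qed.

Lemma fwd_far n j i : i + 2 < n -> 40 < i -> j < 39 -> fwd n j i = false.
Proof. by move=> ni i40 j39; rewrite fwd_link //; lia. Qed.

Lemma fwd_strip n j i : 39 <= j -> j < i -> fwd n j i = (i <= j.+2).
Proof. by move=> j39 ji; rewrite /fwd j39 (ltnNge i) (leq_trans j39 (ltnW ji)). Qed.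

(** Inside the strip a new vertex sees only its two predecessors, while 0, 1, 2 wait in the frontier
    for the far end. The pattern does not depend on [i], so a single transfer step serves the whole
    strip. *)
Lemma strip_frontier n i : 40 < i -> i + 2 < n ->
  [:: true; true; false; false; false] = [seq fwd n j i | j <- [:: i - 1; i - 2; 2; 1; 0]].
Proof.
move=> i40 ni; rewrite /= (@fwd_far n 2) ?(@fwd_far n 1) ?(@fwd_far n 0) //.
by rewrite !fwd_strip; try lia; congr [:: _, _ & _]; lia.
Qed.

Lemma strip_frontier39 n : 43 < n ->
  [:: true; true; false; false; false; false] = [seq fwd n j 39 | j <- [:: 38; 37; 35; 2; 1; 0]].
Proof.
move=> n43; have [n1 n2] : 39 == n.-1 = false /\ 39 == n.-2 = false by lia.
by rewrite /= !fwd_link // n1 n2.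
Qed.

Lemma strip_frontier40 n : 43 < n ->
  [:: true; true; false; false; false] = [seq fwd n j 40 | j <- [:: 39; 35; 2; 1; 0]].
Proof.
move=> n43; have [n1 n2] : 40 == n.-1 = false /\ 40 == n.-2 = false by lia.
by rewrite /= fwd_strip // !fwd_link // n1 n2.
Qed.

Lemma strip_frontier_last2 n : 43 < n ->
  [:: true; true; false; false; true] = [seq fwd n j (n - 2) | j <- [:: n - 3; n - 4; 2; 1; 0]].
Proof.
move=> n43; rewrite /= (@fwd_link n 2) ?(@fwd_link n 1) ?(@fwd_link n 0) //; try lia.
by rewrite !fwd_strip; try lia; rewrite !inE; congr [:: _; _; _; _; _]; lia.
Qed.

Lemma strip_frontier_last n : 43 < n ->
  [:: true; true; true; true; false] = [seq fwd n j (n - 1) | j <- [:: n - 2; n - 3; 2; 1; 0]].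
Proof.
move=> n43; rewrite /= (@fwd_link n 2) ?(@fwd_link n 1) ?(@fwd_link n 0) //; try lia.
by rewrite !fwd_strip; try lia; rewrite !inE; congr [:: _; _; _; _; _]; lia.
Qed.

(* Only used to bring equal states together by sorting, so it need not be injective. *)
Definition code (s : state) : N :=
  foldl (fun a d => N.add (N.shiftl a (N.of_nat 3)) (N.of_nat d)) N0
    ([seq (if x is Some b then nat_of_bool b else 2) | x <- s.1.1] ++
     [:: s.1.2; s.2.1; s.2.2]).

Fixpoint squeeze (ss : seq state) : seq state :=
  if ss is s :: ss' then
    if ss' is t :: _ then if s == t then squeeze ss' else s :: squeeze ss' else ss
  else [::].

Lemma mem_squeeze ss : squeeze ss =i ss.
Proof.
elim: ss => [//|s [//|t ss] IHss] x; rewrite [squeeze _]/=.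
case: eqP => [->|_]; first by rewrite IHss !inE orbA orbb.
by rewrite inE IHss inE.
Qed.

(** Soundness uses only membership; the sorted order is what lets [certificate] compare two lists of
    states by [==]. *)
Definition compress (ss : seq state) : seq state :=
  squeeze (sort (fun s t => N.leb (code s) (code t)) ss).

Lemma mem_compress ss : compress ss =i ss.
Proof. by move=> s; rewrite mem_squeeze mem_sort. Qed.

Section Labelling.

Variables (wS wE budget cap : nat).

(* [nb] selects the neighbours of the new vertex in the frontier; [kp] selects the
   vertices which stay in the frontier. *)
Definition move (nb kp : bitseq) (s : state) (x : option bool) : state :=
  (mask kp (x :: s.1.1),
   s.1.2 + wS * (x == None) + wE * count (conflict x) (mask nb s.1.1),
   (minn cap (s.2.1 + (x == Some true)), minn cap (s.2.2 + (x == Some false)))).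

Definition moves (nb kp : bitseq) (ss : seq state) : seq state :=
  compress [seq s <- [seq move nb kp s x | s <- ss, x <- labels] | s.1.2 <= budget].

Section Cost.

Variables (e : rel nat) (lam : nat -> option bool).

(** A left-right edge is charged to its later endpoint. *)
Definition step_cost (i : nat) : nat :=
  wS * (lam i == None) +
  wE * count (fun j => e j i && conflict (lam i) (lam j)) (iota 0 i).

Definition cost (n : nat) : nat := \sum_(i < n) step_cost i.

Definition population (x : option bool) (n : nat) : nat :=
  count (fun i => lam i == x) (iota 0 n).

(** The recorded cost is only a lower bound: [move] counts conflicts with frontier neighbours alone,
    and an undercount still keeps every labelling within budget among the states. *)
Definition reached (n : nat) (al : seq nat) (ss : seq state) : Prop :=
  [/\ uniq al, {in al, forall j, j < n} &
      cost n <= budget -> exists2 s, s \in ss &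
        [/\ s.1.1 = map lam al, s.1.2 <= cost n &
            s.2 = (minn cap (population (Some true) n), minn cap (population (Some false) n))]].

Lemma costS n : cost n.+1 = cost n + step_cost n.
Proof. by rewrite /cost big_ord_recr. Qed.

Lemma populationS x n : population x n.+1 = population x n + (lam n == x).
Proof. by rewrite /population -addn1 iotaD count_cat /= add0n addn0. Qed.

Lemma minn_addl_min c a b : minn c (minn c a + b) = minn c (a + b).
Proof. by lia. Qed.

Lemma reached_move n al ss nb kp al' : reached n al ss ->
  nb = map (e^~ n) al -> mask kp (n :: al) = al' ->
  reached n.+1 al' (moves nb kp ss).
Proof.
move=> [ual lal H] -> <-; split.
- apply: mask_uniq; rewrite /= ual andbT.
  by apply/negP => /lal; rewrite ltnn.
- by move=> j /mem_mask; rewrite inE => /predU1P[->|/lal] //; apply: ltnW.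
rewrite costS => cn.
have [|s sss [s1 s2 s3]] := H; first exact: leq_trans (leq_addr _ _) cn.
have costle : (move (map (e^~ n) al) kp s (lam n)).1.2 <= cost n + step_cost n.
  rewrite /= -addnA leq_add // leq_add2l leq_mul2l; apply/orP; right.
  (* The frontier is a duplicate-free list of earlier vertices, so the conflicts counted along it
     are at most those in [step_cost]. *)
  rewrite s1 -map_mask count_map -size_filter -[X in _ <= X]size_filter.
  apply: uniq_leq_size; first by rewrite filter_uniq // mask_uniq.
  move=> j; rewrite !mem_filter mem_iota /= add0n => /andP[-> jm].
  have jal := mem_mask jm.
  rewrite lal // !andbT; move: jm; rewrite -filter_mask mem_filter.
  by case/andP.
exists (move (map (e^~ n) al) kp s (lam n)).
  rewrite mem_compress mem_filter (leq_trans costle) //.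
  apply: allpairs_f => //.
  by case: (lam n) => [[]|].
split => //.
  by rewrite map_mask /= s1.
by rewrite /move s3 /= !minn_addl_min !populationS.
Qed.

Lemma reached_start : reached 0 [::] start.
Proof.
by split => // _; exists ([::], 0, (0, 0)); rewrite ?inE.
Qed.

End Cost.

(* The vertices of the three copies which are joined to the strip stay in the
   frontier. *)
Definition front (i : nat) : seq nat :=
  [seq j <- rev (iota 0 i) |
    (j \in [:: 0; 1; 2; 35; 37; 38]) || has (hub j) (iota i (39 - i))].

Definition hub_moves (i : nat) : seq state -> seq state :=
  moves (map (hub^~ i) (front i)) (map (mem (front i.+1)) (i :: front i)).

Definition hub_states : seq state := iteri 39 hub_moves start.

Definition strip_moves : seq state -> seq state :=
  moves [:: true; true; false; false; false] [:: true; true; false; true; true; true].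

(** When 40 is scanned the frontier is 39, 35, 2, 1, 0. Here 35 stands in the place of the second
    predecessor, so [strip_moves] fits this vertex too. *)
Definition strip_states : seq state :=
  strip_moves (moves [:: true; true; false; false; false; false]
    [:: true; false; false; true; true; true; true] hub_states).

Definition final_states : seq state :=
  moves [:: true; true; true; true; false] [::]
    (moves [:: true; true; false; false; true] [:: true; true; false; true; true; true]
      strip_states).

(* The first conjunct says that one more strip vertex does not change the set of
   reachable states. *)
Definition certificate : bool :=
  (strip_moves strip_states == strip_states) &&
  all (fun s => (s.2.1 < cap) || (s.2.2 < cap)) final_states.

Lemma front_mask i : i < 39 ->
  mask (map (mem (front i.+1)) (i :: front i)) (i :: front i) = front i.+1.
Proof.
move=> i39.
have /allP/(_ i) : all (fun i =>
    mask (map (mem (front i.+1)) (i :: front i)) (i :: front i) == front i.+1)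
    (iota 0 39) by vm_compute.
by rewrite mem_iota => /(_ i39)/eqP.
Qed.

Lemma reached_hub n lam i : i <= 39 ->
  reached (fwd n) lam i (front i) (iteri i hub_moves start).
Proof.
elim: i => [|i IHi] i39; first exact: reached_start.
apply: reached_move (IHi (ltnW i39)) _ (front_mask i39).
by apply: eq_map => j; rewrite /fwd i39.
Qed.

Lemma reached_strip n lam i : certificate -> 43 < n -> 41 <= i -> i + 2 < n.+1 ->
  reached (fwd n) lam i [:: i - 1; i - 2; 2; 1; 0] strip_states.
Proof.
case/andP => /eqP closed _ n43; elim: i => [//|i IHi].
rewrite ltnS leq_eqVlt => /predU1P[<- _|i40 ni].
  rewrite /strip_states /strip_moves.
  apply: (@reached_move _ _ _ _ _ _ _ _ _ (strip_frontier40 n43)); last by [].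
  apply: (@reached_move _ _ _ _ _ _ _ _ _ (strip_frontier39 n43)); last by [].
  by have := @reached_hub n lam 39 (leqnn _).
(* The states form a fixed point of [strip_moves], so scanning vertex [i] leaves the same list. *)
rewrite -closed /strip_moves.
have ni' : i + 2 < n by rewrite addSn in ni.
apply: (@reached_move _ _ _ _ _ _ _ _ _ (strip_frontier i40 ni')).
  exact: IHi (ltnW ni).
by rewrite /= !subSS subn0.
Qed.

Lemma certificateP n lam : certificate -> 43 < n -> cost (fwd n) lam n <= budget ->
  population lam (Some true) n < cap \/ population lam (Some false) n < cap.
Proof.
move=> cert n43 cn; have /andP[_ /allP final] := cert.
have nE : n = (n - 2).+2 by lia.
have R : reached (fwd n) lam (n - 2) [:: n - 3; n - 4; 2; 1; 0] strip_states.
  have := @reached_strip n lam (n - 2) cert n43; rewrite -!subnDA; apply; lia.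
have {}R := reached_move R (strip_frontier_last2 n43) (erefl _).
have e1 : (n - 2).+1 = n - 1 by lia.
rewrite e1 in R.
have {}R := R [:: true; true; false; true; true; true].
have {R} := reached_move R (strip_frontier_last n43) (erefl _) => /(_ [::])[_ _].
rewrite (_ : (n - 1).+1 = n); last by lia.
case/(_ cn) => s /final sfin [_ _ s2]; move: sfin; rewrite s2 /= !gtn_min !ltnn !orFb.
by case/orP=> ?; [left | right].
Qed.

End Labelling.

(** A left-right edge costs 4, beyond the budget 3. So when at most three vertices are removed and
    no edge joins the sides, cap 1 forces one side to be empty. *)
Lemma certificate_vertex : certificate 1 4 3 1.
Proof. by vm_compute. Qed.

(** A removal costs 6, beyond the budget 5. So when at most five edges join the sides, cap 2 leaves
    at most one vertex on one of them. *)
Lemma certificate_edge : certificate 6 1 5 2.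
Proof. by vm_compute. Qed.

(** * Vertex cuts and edge cuts as labellings *)

Lemma mem_edges (G : sgraph) (x y : G) : adj x y -> [set x; y] \in edges G.
Proof.
by move=> xy; rewrite inE; apply/existsP; exists x; apply/existsP; exists y; rewrite xy /=.
Qed.

Lemma edgesP (G : sgraph) (e : {set G}) :
  reflect (exists x y : G, adj x y /\ e = [set x; y]) (e \in edges G).
Proof.
rewrite inE; apply: (iffP existsP) => [[x /existsP[y /andP[xy /eqP ->]]]|[x [y [xy ->]]]].
  by exists x, y.
by exists x; apply/existsP; exists y; rewrite xy /=.
Qed.

Section Separation.

Variables (n : nat) (f : 'I_n -> option bool).

Definition extend (i : nat) : option bool := if insub i is Some z then f z else None.

Lemma extendE (z : 'I_n) : extend z = f z.
Proof. by rewrite /extend valK. Qed.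

Lemma population_extend x : population extend x n = #|[set z | f z == x]|.
Proof.
rewrite /population -(card_set_ord_count n (fun i => extend i == x)).
by apply: eq_card => z; rewrite !inE extendE.
Qed.

Lemma cost_extend wS wE : cost wS wE (fwd n) extend n =
  wS * #|[set z | f z == None]| +
  wE * #|[set p : 'I_n * 'I_n | [&& p.1 < p.2, ring_adj n p.1 p.2 & conflict (f p.2) (f p.1)]]|.
Proof.
rewrite /cost big_split /= -!big_distrr /=; congr (_ * _ + _ * _).
  rewrite -sum1_card [RHS]big_mkcond.
  by apply: eq_bigr => z _; rewrite inE extendE; case: (_ == _).
rewrite -sum1_card [RHS]big_mkcond.
rewrite (eq_bigr (fun p : 'I_n * 'I_n =>
  if [&& p.1 < p.2, ring_adj n p.1 p.2 & conflict (f p.2) (f p.1)] then 1 else 0)); last first.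
  by move=> p _; rewrite inE.
(* The sums are exchanged so that the outer index is the later endpoint, as in [step_cost]. *)
rewrite -(pair_bigA _ (fun i j : 'I_n =>
  if [&& i < j, ring_adj n i j & conflict (f j) (f i)] then 1 else 0)) /= exchange_big /=.
apply: eq_bigr => z _; rewrite -big_mkcond sum1_card /=.
rewrite (_ : #|_| =
  #|[set i : 'I_n | [&& i < z, ring_adj n i z & conflict (f z) (extend i)]]|); last first.
  by apply: eq_card => i; rewrite [RHS]inE extendE.
rewrite (@card_set_ord_count n (fun i => [&& i < z, ring_adj n i z & conflict (f z) (extend i)])).
have := iotaD 0 z (n - z); rewrite subnKC ?add0n; last exact: ltnW.
move=> ->; rewrite count_cat [X in _ = _ + X](_ : _ = 0) ?addn0.
  apply: eq_in_count => i; rewrite mem_iota add0n /= => iz.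
  by rewrite iz ring_adj_lt // extendE.
apply/eqP; rewrite eqn0Ngt -has_count; apply/hasPn => i.
by rewrite mem_iota => /andP[zi _]; rewrite ltnNge zi.
Qed.

End Separation.

Lemma ring_vertex_connected m : vertex_connected 4 (ring_graph m).
Proof.
set n := ring_order m; have n43 : 43 < n by rewrite /n /ring_order; lia.
split; first by rewrite card_ord; apply: leq_trans n43.
move=> S S4 x y xS yS; apply/negPn/negP => Nxy.
pose r := [rel u v in ~: S | @adj (ring_graph m) u v].
(* The component of [x] outside [S] against the rest: no edge joins the two sides, so the cost is
   the size of [S]. *)
pose f (z : 'I_n) := if z \in S then None else Some (connect r x z).
have rsym : connect_sym r.
  by apply: sym_connect_sym => u v /=; rewrite (ring_adj_sym _ u) (andbC (u \in _)).
have /certificateP/(_ n43) : certificate 1 4 3 1 := certificate_vertex.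
move=> /(_ (extend f)); rewrite cost_extend !population_extend mul1n.
have -> : #|[set z | f z == None]| = #|S|.
  by apply: eq_card => z; rewrite inE /f; case: ifP.
rewrite [X in 4 * X](_ : _ = 0); last first.
  apply/eqP; rewrite cards_eq0; apply/eqP/setP => -[i j]; rewrite !inE /=.
  apply/negP => /and3P[_ ij]; rewrite /f.
  case: ifP => // jS; case: ifP => // iS /negP; apply; apply/eqP.
  apply: (same_connect_r rsym); apply: connect1.
  by rewrite /= !inE jS iS /= (ring_adj_sym (ring_order m) j i).
rewrite addn0 => /(_ S4); rewrite !ltnS !leqn0 !cards_eq0.
case=> /eqP/setP.
  by move/(_ x); rewrite !inE /f connect0; move: xS; rewrite inE => /negbTE->.
by move/(_ y); rewrite !inE /f (negbTE Nxy); move: yS; rewrite inE => /negbTE->.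
Qed.

Lemma ring_essentially_edge_connected m : essentially_edge_connected 6 (ring_graph m).
Proof.
set n := ring_order m; have n43 : 43 < n by rewrite /n /ring_order; lia.
move=> X X0 XT cutX.
pose f (z : 'I_n) := Some (z \in X).
have /certificateP/(_ n43) : certificate 6 1 5 2 := certificate_edge.
move=> /(_ (extend f)); rewrite cost_extend !population_extend mul1n.
have -> : [set z | f z == None] = set0 by apply/setP => z; rewrite !inE.
have -> : [set z | f z == Some true] = X by apply/setP => z; rewrite !inE /f eqE /= eqb_id.
have -> : [set z | f z == Some false] = ~: X.
  by apply/setP => z; rewrite !inE /f eqE /= eqbF_neg.
rewrite cards0 muln0 add0n => H.
(* A side reduced to one vertex [v] gives a cut all of whose edges contain [v]. *)
have [X1|X1] : #|X| < 2 \/ #|~: X| < 2.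
- apply: H; rewrite -ltnS; apply: leq_ltn_trans cutX.
  pose g (p : 'I_n * 'I_n) := [set p.1; p.2].
  rewrite -(@card_in_imset _ _ g); last first.
    move=> [i j] [k l]; rewrite !inE /= => /and3P[ij _ _] /and3P[kl _ _].
    rewrite /g /= => /setP E; have Ei := E i; have Ej := E j; have Ek := E k.
    move: Ei Ej Ek; rewrite !inE !eqxx /= ?orbT.
    rewrite -!(inj_eq val_inj) /= => Ei Ej Ek.
    by congr (_, _); apply: val_inj => /=; lia.
  apply/subset_leq_card/subsetP => e /imsetP[[i j]]; rewrite inE /= => /and3P[_ ij cij] ->.
  rewrite inE mem_edges //=; apply/andP.
  move: cij; rewrite /conflict /f /g /=.
  have [jX|jX] := boolP (j \in X); have [iX|iX] := boolP (i \in X) => // _.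
    by split; apply/set0Pn; [exists j | exists i]; rewrite !inE ?jX ?iX eqxx ?orbT.
  by split; apply/set0Pn; [exists i | exists j]; rewrite !inE ?jX ?iX eqxx ?orbT.
- have /cards1P[v XE] : #|X| == 1 by rewrite eqn_leq -ltnS X1 card_gt0.
  exists v => e; rewrite inE => /and3P[_ /set0Pn[u]].
  by rewrite inE XE inE => /andP[ue /eqP <-].
- have /cards1P[v XE] : #|~: X| == 1.
    by rewrite eqn_leq -ltnS X1 card_gt0 -(inj_eq (@setC_inj _)) setCK setC0.
  exists v => e; rewrite inE => /and3P[_ _ /set0Pn[u]].
  by rewrite inE -in_setC XE inE => /andP[/eqP <-].
Qed.

(** * Claws and independent sets *)

(** Double counting: each edge comes from exactly two ordered adjacent pairs. *)
Lemma card_regular_edges (G : sgraph) k : regular k G -> 2 * #|edges G| = k * #|G|.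
Proof.
move=> regG; pose g (p : G * G) := [set p.1; p.2].
pose A := [set p : G * G | adj p.1 p.2].
have <- : #|A| = k * #|G|.
  rewrite -sum1_card (eq_bigl (fun p : G * G => adj p.1 p.2)); last by move=> p; rewrite inE.
  rewrite -(pair_big_dep xpredT (fun x y : G => adj x y) (fun _ _ => 1)) /=.
  rewrite (eq_bigr (fun=> k)); first by rewrite sum_nat_const mulnC.
  by move=> x _; rewrite sum1_card -(regG x) cardsE.
rewrite -[#|A|]sum1_card (partition_big g (mem (edges G))) /=; last first.
  by move=> p; rewrite inE; apply: mem_edges.
rewrite (eq_bigr (fun=> 2)); first by rewrite sum_nat_const mulnC.
move=> e /edgesP[x [y [xy ->]]].
have nxy : x != y by apply: contraTneq xy => ->; rewrite adj_irrefl.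
rewrite sum1_card (_ : 2 = #|[set (x, y); (y, x)]|); last first.
  by rewrite cards2 xpair_eqE (negbTE nxy).
apply: eq_card => -[u v].
rewrite -[LHS]/(((u, v) \in A) && (g (u, v) == [set x; y])) !inE /= !xpair_eqE.
apply/andP/idP => [[uv /eqP/setP E]|].
  have nuv : u != v by apply: contraTneq uv => ->; rewrite adj_irrefl.
  have := E u; have := E v; rewrite !inE !eqxx orbT /=.
  move=> /esym/orP[]/eqP vE /esym/orP[]/eqP uE; subst; rewrite ?eqxx ?orbT // in nuv *.
case/orP=> /andP[/eqP-> /eqP->]; first by rewrite xy.
by rewrite adj_sym xy; split => //; rewrite /g /= setUC.
Qed.

Definition independent (G : sgraph) (I : {set G}) : Prop :=
  {in I &, forall x y, ~~ adj x y}.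

Lemma claw_decomposition_independent (G : sgraph) (P : {set {set {set G}}}) :
  regular 4 G -> claw_decomposition P ->
  exists2 I : {set G}, independent I & #|G| <= 3 * #|I|.
Proof.
move=> regG [partP clawP].
(* The centre of a claw lies on all its edges, so [pick] does not return [None] on a block of
   [P]. *)
pose centre (D : {set {set G}}) := [pick c | [forall e in D, c \in e]].
have card3 : {in P, forall D : {set {set G}}, #|D| = 3}.
  move=> D /clawP[c [L [cL L3 ->]]]; rewrite -L3 card_in_imset // => x y xL yL E.
  have : x \in [set c; y] by rewrite -E !inE eqxx orbT.
  by rewrite !inE => /predU1P[xc|/eqP//]; rewrite -xc xL in cL.
have cardE : #|edges G| = #|P| * 3 by apply: card_uniform_partition partP.
have cardG := card_regular_edges regG.
pose C := [set c | Some c \in centre @: P].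
have cardC : #|C| <= #|P|.
  apply: leq_trans (leq_imset_card centre _).
  rewrite -(card_imset _ Some_inj); apply/subset_leq_card/subsetP => oc /imsetP[c cC ->].
  by move: cC; rewrite inE.
(* From [2 * #|edges G| = 4 * #|G|] and three edges per claw, [C] has at most two thirds of the
   vertices. *)
exists (~: C) => [x y|]; last by have := cardsC C; lia.
rewrite !inE => xC yC; apply/negP => /mem_edges.
have /and3P[/eqP <- _ _] := partP.
case/bigcupP => D DP xyD.
have := imset_f centre DP; rewrite /centre; case: pickP => [c /forall_inP/(_ _ xyD)|none _].
  by rewrite !inE => /orP[]/eqP-> cP; rewrite cP in xC yC.
have [c [L [_ _ DE]]] := clawP D DP.
have /negP[] := none c; apply/forall_inP => e.
by rewrite DE => /imsetP[z _ ->]; rewrite !inE eqxx.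
Qed.

(** * Independence number of the ring *)

Fixpoint all_bitseqs (n : nat) (p : pred bitseq) : bool :=
  if n is n'.+1 then
    all_bitseqs n' (fun s => p (true :: s)) && all_bitseqs n' (fun s => p (false :: s))
  else p [::].

Lemma all_bitseqsP n (p : pred bitseq) s : all_bitseqs n p -> size s = n -> p s.
Proof.
elim: n p s => [|n IHn] p [|b s] //= /andP[pt pf] [sn].
by case: b; [apply: (IHn (fun s => p (true :: s))) | apply: (IHn (fun s => p (false :: s)))].
Qed.

(** Exhaustion over the [2 ^ 13] vertex subsets of the gadget. *)
Lemma gadget_independence (s : bitseq) : size s = 13 ->
  all (fun p => ~~ (nth false s p.1 && nth false s p.2)) gadget -> count id s <= 4.
Proof.
move=> s13 indep.
have : all_bitseqs 13 (fun s =>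
    all (fun p => ~~ (nth false s p.1 && nth false s p.2)) gadget ==> (count id s <= 4)).
  by vm_compute.
by move/all_bitseqsP/(_ s13); rewrite indep.
Qed.

(** Each gadget copy contributes at most 4 and each of the [2 * m + 2] strip triangles at most 1, so
    three times the total is at most [6 * m + 42]. *)
Lemma ring_independence m (I : {set ring_graph m}) :
  independent I -> 3 * #|I| < ring_order m.
Proof.
set n := ring_order m => indI.
have nE : n = 39 + 3 * (2 * m + 2) by rewrite /n /ring_order; lia.
pose a i := if insub i is Some z then (z : 'I_n) \in I else false.
have aE (z : 'I_n) : a z = (z \in I) by rewrite /a valK.
have indep i j : i < n -> j < n -> ring_adj n i j -> ~~ (a i && a j).
  move=> im jm ij; rewrite (aE (Ordinal im)) (aE (Ordinal jm)).
  by apply/negP => /andP[iI jI]; have := indI _ _ iI jI; rewrite /= ij.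
have -> : #|I| = count a (iota 0 n).
  by rewrite -card_set_ord_count; apply: eq_card => z; rewrite inE aE.
have block c : c < 3 -> count a (iota (13 * c) 13) <= 4.
  move=> c3; have := @gadget_independence [seq a i | i <- iota (13 * c) 13].
  rewrite count_map; apply; first by rewrite size_map size_iota.
  apply/allP => -[i j] ij; rewrite /fst /snd.
  have /allP/(_ _ ij)/and3P[] : all (fun p => [&& p.1 < 13, p.2 < 13 & p.1 < p.2]) gadget by [].
  rewrite /fst /snd => i13 j13 iltj.
  rewrite !(nth_map 0) ?size_iota // !nth_iota //.
  have [ci cj] : 13 * c + i < 39 /\ 13 * c + j < 39 by clear -c3 i13 j13; lia.
  apply: indep; rewrite ?nE ?ltn_addr // ring_adj_hub //.
  rewrite /hub_adj ltn_add2l iltj /hub.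
  rewrite !(mulnC 13) !divnMDl // !divn_small // eqxx !modnMDl !modn_small //.
  by rewrite ij.
have strip t : t <= 2 * m + 2 -> count a (iota 39 (3 * t)) <= t.
  elim: t => [//|t IHt] tm; rewrite mulnS addnC iotaD count_cat -[t.+1]addn1.
  apply: leq_add; first exact/IHt/ltnW.
  have e i j : i < j -> j < 3 -> ~~ (a (39 + 3 * t + i) && a (39 + 3 * t + j)).
    move=> ij j3; have [ti tj] : 39 + 3 * t + i < n /\ 39 + 3 * t + j < n.
      by rewrite nE; clear -tm ij j3; lia.
    apply: indep => //; rewrite ring_adj_strip -?addnA ?leq_addr //.
    by clear -ij j3; lia.
  move: (e 0 1 isT isT) (e 0 2 isT isT) (e 1 2 isT isT); rewrite addn0 addn1 addn2.
  by rewrite /=; do 3!case: (a _).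
have -> : iota 0 n = iota 0 13 ++ iota 13 13 ++ iota 26 13 ++ iota 39 (3 * (2 * m + 2)).
  by rewrite nE (iotaD 0 39) (iotaD 0 13 26) (iotaD 13 13 13) -!catA.
rewrite !count_cat nE.
move: (strip _ (leqnn _)) (block 0 isT) (block 1 isT) (block 2 isT).
rewrite muln0 muln1 (_ : 13 * 2 = 26) //.
move: (count a _) (count a _) (count a _) (count a _) => c1 c2 c3 c4.
by clear; lia.
Qed.

Lemma ring_no_claw_decomposition m :
  ~ exists P : {set {set {set ring_graph m}}}, claw_decomposition P.
Proof.
case=> P /(claw_decomposition_independent (@ring_graph_regular m))[I /ring_independence].
by rewrite card_ord; lia.
Qed.

Lemma ring_edges_mod3 m : 3 %| #|edges (ring_graph m)|.
Proof.
have := card_regular_edges (@ring_graph_regular m); rewrite card_ord /ring_order.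
by lia.
Qed.

Lemma ring_graph_inj i j : isomorphic (ring_graph i) (ring_graph j) -> i = j.
Proof.
by case=> f /bij_eq_card; rewrite !card_ord /ring_order => E _; lia.
Qed.

(** * A straight-line drawing *)

Delimit Scope Z_scope with BZ.

(* The last four sites are the corners of the rectangle filled by the strip; they are
   occupied by the vertices [39], [40], [n - 2] and [n - 1]. *)
Definition site : seq (Z * Z) :=
  ([:: (11, 6); (14, 5); (22, 11); (11, 9); (10, 9); (17, 10); (21, 14);
      (8, 10); (16, 18); (15, 21); (11, 14); (8, 11); (12, 16);
      (7, 12); (10, 19); (10, 25); (7, 15); (5, 11); (6, 20); (4, 27);
      (4, 12); (5, 19); (0, 22); (2, 16); (3, 12); (1, 17);
      (1, 11); (-1, 15); (-1, 25); (0, 12); (1, 10); (-4, 14); (-9, 15);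
      (-2, 10); (-6, 12); (-10, 10); (-4, 9); (0, 8); (-4, 5);
      (0, 1); (0, 0); (10, 1); (10, 0)])%BZ.

Definition site_of (i : nat) : Z * Z := nth (0, 0)%BZ site i.

Definition site_edges : seq (nat * nat) :=
  [seq p <- [seq (i, j) | i <- iota 0 39, j <- iota 0 39] | (p.1 < p.2) && hub p.1 p.2] ++
  [:: (37, 39); (38, 39); (35, 40); (1, 42); (2, 42); (0, 41)].

Definition affine : Type := (Z * Z * Z)%type.

Definition eval_affine (l : affine) (p : Z * Z) : Z := (l.1.1 * p.1 + l.1.2 * p.2 + l.2)%BZ.

(** The weak inequalities allow a shared endpoint; the strict one makes the functional positive at
    some end of [e], hence on its whole interior. *)
Definition separates (l : affine) (e f : (Z * Z) * (Z * Z)) : bool :=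
  [&& Z.leb 0 (eval_affine l e.1), Z.leb 0 (eval_affine l e.2),
      Z.ltb 0 (eval_affine l e.1 + eval_affine l e.2),
      Z.leb (eval_affine l f.1) 0 & Z.leb (eval_affine l f.2) 0].

Definition line (e : (Z * Z) * (Z * Z)) : affine :=
  let: ((x, y), (x', y')) := e in (y - y', x' - x, x * y' - x' * y)%BZ.

(* The two sides of the line through [f], and the lines parallel to [e] on either side. *)
Definition candidates (e f : (Z * Z) * (Z * Z)) : seq affine :=
  let: (a, b, c) := line f in let: (a', b', c') := line e in
  [:: (a, b, c); (- a, - b, - c); (a', b', c' + 1); (- a', - b', 1 - c')]%BZ.

Definition segment_of (p : nat * nat) := (site_of p.1, site_of p.2).

Lemma site_edges_separated p q : p \in site_edges -> q \in site_edges -> p != q ->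
  exists l, separates l (segment_of p) (segment_of q).
Proof.
move=> pE qE pq.
have /allP/(_ _ pE)/allP/(_ _ qE) : all (fun p => all (fun q =>
    (p == q) || has (fun l => separates l (segment_of p) (segment_of q))
      (candidates (segment_of p) (segment_of q))) site_edges) site_edges.
  by vm_compute.
by rewrite (negbTE pq) /= => /hasP[l _ sl]; exists l.
Qed.

(* The value [s] is the maximum of [a * x + b * y] on the rectangle [[0, 10] x [0, 1]]. *)
Definition above_strip (a b : Z) (e : (Z * Z) * (Z * Z)) : bool :=
  let s := (Z.max (10 * a) 0 + Z.max b 0)%BZ in
  [&& Z.leb 0 (eval_affine (a, b, - s)%BZ e.1), Z.leb 0 (eval_affine (a, b, - s)%BZ e.2) &
      Z.ltb 0 (eval_affine (a, b, - s)%BZ e.1 + eval_affine (a, b, - s)%BZ e.2)].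

(** Nonzero [a] and [b] make the maximum over the rectangle occur at a single corner, which later
    yields strictness for strip edges. *)
Lemma site_edges_above_strip p : p \in site_edges -> exists a b,
  [/\ Z.eqb a 0 = false, Z.eqb b 0 = false & above_strip a b (segment_of p)].
Proof.
move=> pE.
have /allP/(_ _ pE)/hasP[[a b] _ /and3P[/negbTE a0 /negbTE b0 ab]] : all (fun p =>
    has (fun n => [&& ~~ Z.eqb n.1 0, ~~ Z.eqb n.2 0 & above_strip n.1 n.2 (segment_of p)])
      [:: (-1, 4); (2, -1); (1, 1); (-2, -1)]%BZ) site_edges by vm_compute.
by exists a, b.
Qed.

Lemma uniq_site : uniq site.
Proof. by vm_compute. Qed.

(** The strip has ordinates between 0 and 1, so hub vertices cannot collide with it. *)
Lemma site_hub_high i : i < 39 -> Z.ltb 1 (site_of i).2.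
Proof.
move=> i39; have /allP/(_ i) : all (fun i => Z.ltb 1 (site_of i).2) (iota 0 39) by vm_compute.
by rewrite mem_iota => /(_ i39).
Qed.

(** The last two vertices go to the sites of the right-hand corners, so that one finite list
    [site_edges] serves every [n]. *)
Definition site_index (n i : nat) : nat :=
  if i == n - 2 then 41 else if i == n - 1 then 42 else i.

Lemma site_edge_fwd n i j : 43 < n -> i < 39 -> i < j -> fwd n i j ->
  (i, site_index n j) \in site_edges /\
  (39 <= j -> j \in [:: 39; 40; n - 2; n - 1]).
Proof.
move=> n43 i39 ij; have [j39|j39] := ltnP j 39.
  rewrite /fwd j39 => h; split=> //.
  have -> : site_index n j = j by rewrite /site_index; do !case: ifP => //; lia.
  rewrite mem_cat mem_filter; apply/orP; left; apply/andP; split.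
    by rewrite /fst /snd ij h.
  by apply: (allpairs_f pair); rewrite mem_iota ?i39 ?j39.
rewrite fwd_link // => h; split; last by move=> _; move: h; rewrite !inE; lia.
have [n39 n40] : n - 2 != 39 /\ n - 1 != 40 by lia.
rewrite mem_cat; apply/orP; right; move: h.
case/or4P => /andP[/eqP-> h].
- by rewrite /site_index !ifN_eqC; try lia; move: h; rewrite !inE => /orP[]/eqP->.
- by rewrite /site_index !ifN_eqC; try lia; rewrite (eqP h).
- rewrite /site_index -subn1 eqxx ifN_eqC; last by lia.
  by move: h; rewrite !inE => /orP[]/eqP->.
- by rewrite /site_index -subn2 eqxx (eqP h).
Qed.

(** Strip vertices other than corners are excluded because [site_index] fixes them, and 41 or 42
    would clash with the image of a corner. *)
Lemma site_index_inj n i j : 43 < n ->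
  (39 <= i -> i \in [:: 39; 40; n - 2; n - 1]) ->
  (39 <= j -> j \in [:: 39; 40; n - 2; n - 1]) ->
  site_index n i = site_index n j -> i = j.
Proof.
rewrite !inE /site_index => n43 hi hj.
by case: (i =P n - 2) => ?; case: (j =P n - 2) => ?; case: (i =P n - 1) => ?;
   case: (j =P n - 1) => ?; try lia.
Qed.

Section Ends.

Variable m : nat.
Let n := ring_order m.

Definition ends (e : {set 'I_n}) : option ('I_n * 'I_n) :=
  [pick p : 'I_n * 'I_n | (p.1 < p.2) && (e == [set p.1; p.2])].

Lemma endsP (e : {set ring_graph m}) : e \in edges (ring_graph m) ->
  exists i j : 'I_n, [/\ i < j, fwd n i j, e = [set i; j] & ends e = Some (i, j)].
Proof.
case/edgesP => x [y [xy eE]]; rewrite /ends.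
have [i [j [ij fij {}eE]]] : exists i j : 'I_n, [/\ i < j, fwd n i j & e = [set i; j]].
  have [/andP[? ?]|/andP[? ?]] := orP xy; first by exists x, y.
  by exists y, x; split; rewrite // setUC.
exists i, j; split => //; case: pickP => [[k l] /= /andP[kl /eqP E]|/(_ (i, j))]; last first.
  by rewrite /= ij eE eqxx.
have /setP E' := etrans (esym eE) E.
have := E' i; have := E' j; have := E' k; rewrite !inE !eqxx /= ?orbT.
rewrite -!(inj_eq val_inj) /= => h1 h2 h3.
by congr (Some (_, _)); apply: val_inj => /=; lia.
Qed.

(** A vertex inside the arc of [e] also lies on the closed arc of such an [f], so avoidance of
    vertices reduces to disjointness of arcs. *)
Lemma other_edge (e : {set ring_graph m}) (z : ring_graph m) :
  exists2 f, f \in edges (ring_graph m) & (f != e) && (z \in f).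
Proof.
have : 1 < #|[set y | @adj (ring_graph m) z y]| by rewrite ring_graph_regular.
case/card_gt1P => x [y []]; rewrite !inE => zx zy xy.
have [eE|eE] := eqVneq [set z; x] e; last first.
  by exists [set z; x]; rewrite ?mem_edges // eE !inE eqxx.
exists [set z; y]; rewrite ?mem_edges // -eE !inE eqxx /= andbT.
apply: contra xy => /eqP/setP/(_ x); rewrite !inE eqxx orbT => /orP[|/eqP->//].
by move/eqP=> xz; move: zx; rewrite xz adj_irrefl.
Qed.

End Ends.

From mathcomp Require Import all_classical all_reals all_analysis.

Section Drawing.

Import Order.TTheory GRing.Theory Num.Theory.
Import numFieldNormedType.Exports.
Local Open Scope classical_set_scope.
Local Open Scope ring_scope.

Variable R : realType.

(** * Segments and separating functionals over the reals *)

Definition segment (p q : R * R) (t : R) : R * R :=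
  ((1 - t) * p.1 + t * q.1, (1 - t) * p.2 + t * q.2).

Lemma segment0 p q : segment p q 0 = p.
Proof. by case: p => x y; rewrite /segment !subr0 !mul1r !mul0r !addr0. Qed.

Lemma segment1 p q : segment p q 1 = q.
Proof. by case: q => x y; rewrite /segment !subrr !mul1r !mul0r !add0r. Qed.

Lemma convex_comb_continuous (a b : R) : continuous (fun t : R => (1 - t) * a + t * b).
Proof.
move=> t; apply: cvgD; (apply: cvgM; [|exact: cvg_cst]); last exact: cvg_id.
by apply: cvgB; [exact: cvg_cst | exact: cvg_id].
Qed.

Lemma segment_continuous p q : continuous (segment p q).
Proof.
move=> t; have h1 := @convex_comb_continuous p.1 q.1 t.
have h2 := @convex_comb_continuous p.2 q.2 t.
exact: cvg_pair h1 h2.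
Qed.

Lemma segment_inj p q : p <> q -> injective (segment p q).
Proof.
case: p q => [x y] [x' y'] pq t u [/= ex ey].
apply/eqP; apply: contra_notT pq; rewrite -subr_eq0 => tu.
have hx : (t - u) * (x' - x) = 0 by lra.
have hy : (t - u) * (y' - y) = 0 by lra.
move/eqP: hx; move/eqP: hy; rewrite !mulf_eq0 (negbTE tu) /= !subr_eq0.
by move=> /eqP -> /eqP ->.
Qed.

Definition separated (p q r s : R * R) : Prop :=
  exists a b c : R, let l z := a * z.1 + b * z.2 + c in
    [/\ 0 <= l p, 0 <= l q, 0 < l p + l q, l r <= 0 & l s <= 0].

(** By convexity the functional is positive inside the first segment and nonpositive on all of the
    second. *)
Lemma separated_disjoint p q r s : separated p q r s ->
  segment p q @` `]0, 1[ `&` segment r s @` `[0, 1] = set0.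
Proof.
case=> a [b [c [lp lq lpq lr ls]]]; rewrite -subset0 => z [[t]].
rewrite /= in_itv /= => /andP[t0 t1] tz [u]; rewrite in_itv /= => /andP[u0 u1] uz.
pose l (z : R * R) := a * z.1 + b * z.2 + c.
have {}lp : 0 <= l p by []. have {}lq : 0 <= l q by []. have {}lpq : 0 < l p + l q by [].
have {}lr : l r <= 0 by []. have {}ls : l s <= 0 by [].
have ltz : l z = (1 - t) * l p + t * l q by rewrite -tz /l /segment /=; ring.
have luz : l z = (1 - u) * l r + u * l s by rewrite -uz /l /segment /=; ring.
clearbody l; move: (l p) (l q) (l r) (l s) ltz luz lp lq lpq lr ls => lp lq lr ls.
move=> ltz luz lp0 lq0 lpq lr0 ls0.
have : 0 < (1 - t) * lp + t * lq.
  have [lp1|lp1] := ltP 0 lp.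
    by apply: ltr_wpDr; [apply: mulr_ge0 => //; lra | apply: mulr_gt0 => //; lra].
  by apply: ltr_wpDl; [apply: mulr_ge0 => //; lra | apply: mulr_gt0 => //; lra].
have : (1 - u) * lr <= 0 by apply: mulr_ge0_le0 => //; lra.
have : u * ls <= 0 by apply: mulr_ge0_le0.
by rewrite -ltz; lra.
Qed.

(** Transfers to [R] the inequalities checked by computation in [Z]. *)
Definition zr (z : Z) : R := (int_of_Z z)%:~R.

Lemma zrD a b : zr (Z.add a b) = zr a + zr b.
Proof. by rewrite /zr -[Z.add a b]/(a + b) rmorphD /= intrD. Qed.

Lemma zrM a b : zr (Z.mul a b) = zr a * zr b.
Proof. by rewrite /zr -[Z.mul a b]/(a * b) rmorphM /= intrM. Qed.

Lemma zrN a : zr (Z.opp a) = - zr a.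
Proof. by rewrite /zr -[Z.opp a]/(- a) rmorphN /= rmorphN. Qed.

Lemma zr_ge0 z : Z.leb 0 z -> 0 <= zr z.
Proof. by rewrite /zr ler0z; case: z. Qed.

Lemma zr_gt0 z : Z.ltb 0 z -> 0 < zr z.
Proof. by rewrite /zr ltr0z; case: z => // p _; rewrite /=; lia. Qed.

Lemma zr_le0 z : Z.leb z 0 -> zr z <= 0.
Proof. by move=> z0; rewrite -oppr_ge0 -zrN zr_ge0 //; lia. Qed.

Lemma zr_nat (k : nat) : zr (Z.of_nat k) = k%:R.
Proof. by rewrite /zr (_ : int_of_Z (Z.of_nat k) = k%:Z) //; lia. Qed.

Lemma zr_max z : zr (Z.max z 0) = Num.max (zr z) 0.
Proof.
have [z0|z0] := boolP (Z.leb 0 z).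
  by rewrite max_l ?zr_ge0 // (_ : Z.max z 0 = z) //; lia.
have z0' : Z.leb z 0 by lia.
by rewrite max_r ?zr_le0 // (_ : Z.max z 0 = 0%BZ) //; lia.
Qed.

Lemma zr_neq0 z : Z.eqb z 0 = false -> zr z != 0.
Proof. by rewrite /zr intr_eq0; case: z => // p _; rewrite /=; lia. Qed.

Lemma zr_inj : injective zr.
Proof. by move=> y z /intr_inj; lia. Qed.

Definition pt (z : Z * Z) : R * R := (zr z.1, zr z.2).

Lemma zr_affine l z : zr (eval_affine l z) = zr l.1.1 * (pt z).1 + zr l.1.2 * (pt z).2 + zr l.2.
Proof. by rewrite /eval_affine !zrD !zrM. Qed.

Lemma separates_separated l e f :
  separates l e f -> separated (pt e.1) (pt e.2) (pt f.1) (pt f.2).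
Proof.
case/and5P => e1 e2 e12 f1 f2; exists (zr l.1.1), (zr l.1.2), (zr l.2) => /=.
rewrite -!zr_affine -zrD.
by split; [exact: zr_ge0 | exact: zr_ge0 | exact: zr_gt0 | exact: zr_le0 | exact: zr_le0].
Qed.

(** A linear function of nonzero slope on an interval attains its maximum at one end only. *)
Lemma corner_gap (a x c : R) : a != 0 -> 0 <= x -> x <= c ->
  0 <= Num.max (c * a) 0 - a * x /\
  (Num.max (c * a) 0 - a * x = 0 -> x = if 0 < a then c else 0).
Proof.
move=> a0 x0 xc; have c0 : 0 <= c by lra.
case: (ltrgtP 0 a) a0 => // a0 _.
  rewrite max_l; last by apply: mulr_ge0 => //; lra.
  have h : 0 <= a * (c - x) by apply: mulr_ge0; lra.
  split; first by lra.
  move=> e; have /eqP : a * (c - x) = 0 by lra.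
  by rewrite mulf_eq0 gt_eqF //= subr_eq0 => /eqP.
rewrite max_r; last by apply: mulr_ge0_le0 => //; lra.
have h : a * x <= 0 by apply: mulr_le0_ge0; lra.
split; first by lra.
move=> e; have /eqP : a * x = 0 by lra.
by rewrite mulf_eq0 lt_eqF //= => /eqP.
Qed.

Lemma sum4_eq0 (w x y z : R) : 0 <= w -> 0 <= x -> 0 <= y -> 0 <= z ->
  w + x + y + z <= 0 -> [/\ w = 0, x = 0, y = 0 & z = 0].
Proof. by move=> *; split; lra. Qed.

Definition in_strip (u : R * R) : Prop := [/\ 0 <= u.1, u.1 <= 10, 0 <= u.2 & u.2 <= 1].

Lemma above_strip_separated a b e u v :
  Z.eqb a 0 = false -> Z.eqb b 0 = false -> above_strip a b e ->
  in_strip u -> in_strip v -> u <> v ->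
  separated (pt e.1) (pt e.2) u v /\ separated u v (pt e.1) (pt e.2).
Proof.
rewrite /above_strip; set z := Z.add _ _.
have zE : zr z = Num.max (10 * zr a) 0 + Num.max (zr b) 0.
  by rewrite zrD !zr_max zrM (zr_nat 10).
clearbody z => a0 b0 /and3P[e1 e2 e12] [u1 u1' u2 u2'] [v1 v1' v2 v2'] uv.
move: (zr_ge0 e1) (zr_ge0 e2) (zr_gt0 e12); rewrite zrD !zr_affine /= zrN zE.
set s := Num.max _ 0 + Num.max _ 0 => h1 h2 h12.
have [gu1 zu1] := corner_gap (zr_neq0 a0) u1 u1'.
have [gv1 zv1] := corner_gap (zr_neq0 a0) v1 v1'.
have [gu2 zu2] := corner_gap (zr_neq0 b0) u2 u2'.
have [gv2 zv2] := corner_gap (zr_neq0 b0) v2 v2'.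
rewrite !mul1r in gu2 zu2 gv2 zv2.
have su : zr a * u.1 + zr b * u.2 <= s by rewrite /s; clear -gu1 gu2; lra.
have sv : zr a * v.1 + zr b * v.2 <= s by rewrite /s; clear -gv1 gv2; lra.
(* Equality would put both [u] and [v] at the unique maximising corner. *)
have suv : zr a * u.1 + zr b * u.2 + (zr a * v.1 + zr b * v.2) < s + s.
  rewrite ltNge; apply/negP => h; apply: uv.
  have := sum4_eq0 gu1 gu2 gv1 gv2; case; first by rewrite /s in h; clear -h; lra.
  move=> /zu1 eu1 /zu2 eu2 /zv1 ev1 /zv2 ev2.
  by rewrite (surjective_pairing u) (surjective_pairing v) eu1 eu2 ev1 ev2.
clearbody s; split; [exists (zr a), (zr b), (- s) | exists (- zr a), (- zr b), s] => /=.
  by clear -h1 h2 h12 su sv; split; lra.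
by clear -h1 h2 h12 su sv suv; split; lra.
Qed.

(** * Positions of the strip and assembly of the drawing *)

Section Positions.

Variable m : nat.
Let n := ring_order m.

(** Even [k] form the upper row and odd [k] the lower one; the columns 0 to [3 * m + 2] are spread
    over the width 10. *)
Definition strip_pt (k : nat) : R * R :=
  (10 * k./2%:R / (3 * m + 2)%:R, (~~ odd k)%:R).

(* With [X] the abscissa rescaled to [k./2], the index of a strip vertex is the affine
   function [2 * X + 1 - y]. *)
Lemma strip_affine (a b c : R) : exists a' b' c' : R, forall k,
  a' * (strip_pt k).1 + b' * (strip_pt k).2 + c' = a * k%:R + b * (~~ odd k)%:R + c.
Proof.
exists (a * 2 * (3 * m + 2)%:R / 10), (b - a), (c + a) => k; rewrite /strip_pt.
have -> : k%:R = (odd k)%:R + 2 * k./2%:R :> R.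
  by rewrite -[in LHS](odd_double_half k) natrD -mul2n natrM.
have p0 : (3 * m + 2)%:R != 0 :> R by rewrite pnatr_eq0 addn2.
by move: ((3 * m + 2)%:R : R) p0 => p p0; case: (odd k) => /=; rewrite ?mulr0n ?mulr1n; field.
Qed.

Lemma strip_separated k d l c : (0 < d <= 2)%N -> (0 < c <= 2)%N -> (k, d) != (l, c) ->
  separated (strip_pt k) (strip_pt (k + d)) (strip_pt l) (strip_pt (l + c)).
Proof.
move=> d2 c2 kl.
suff [a [b [g [h1 h2 h3 h4 h5]]]] : exists a b g : R,
    let f i := a * i%:R + b * (~~ odd i)%:R + g in
    [/\ 0 <= f k, 0 <= f (k + d)%N, 0 < f k + f (k + d)%N, f l <= 0 & f (l + c)%N <= 0].
  have [a' [b' [g' E]]] := strip_affine a b g.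
  by exists a', b', g' => /=; rewrite !E.
(* Index ranges that at most touch are separated by the index itself. *)
have [kdl|] := leqP (k + d) l.
  exists (-1), 0, l%:R => /=; move: kdl; rewrite -(ler_nat R) !natrD.
  have : 0 < d%:R :> R by rewrite ltr0n; lia.
  have : 0 < c%:R :> R by rewrite ltr0n; lia.
  by split; lra.
have [lck|] := leqP (l + c) k.
  exists 1, 0, (- (l + c)%:R) => /=; move: lck; rewrite -(ler_nat R) !natrD.
  have : 0 < d%:R :> R by rewrite ltr0n; lia.
  have : 0 < c%:R :> R by rewrite ltr0n; lia.
  by split; lra.
move=> kl1 kl2.
(* Steps are at most 2, so overlapping index ranges start at the same vertex or one apart. *)
have : [\/ [/\ k = l, d = 1%N & c = 2%N], [/\ k = l, d = 2%N & c = 1%N],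
   [/\ l = k.+1, d = 2%N & c = 1%N \/ c = 2%N] |
   [/\ k = l.+1, c = 2%N & d = 1%N \/ d = 2%N]].
  have [kl0|[kl0|kl0]] : k = l \/ l = k.+1 \/ k = l.+1 by lia.
  - move: kl; rewrite kl0 xpair_eqE eqxx /= => /eqP dc.
    have : (d = 1 /\ c = 2)%N \/ (d = 2 /\ c = 1)%N by lia.
    by case=> -[-> ->]; [apply: Or41 | apply: Or42].
  - by apply: Or43; split; lia.
  - by apply: Or44; split; lia.
pose s (i : nat) : R := (odd i)%:R.
have sE i : (~~ odd i)%:R = 1 - s i by rewrite /s; case: (odd i); rewrite ?subrr ?subr0.
have sS i : s (i + 1)%N = 1 - s i by rewrite addn1 -sE.
have sS1 i : s i.+1 = 1 - s i by rewrite -addn1 sS.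
have sSS i : s (i + 2)%N = s i by rewrite addn2 /s /= negbK.
have s01 i : s i = 0 \/ s i = 1 by rewrite /s; case: (odd i); [right | left].
(* The functional [s i * y + (1 - s i) * (1 - y)] vanishes on the row of [i] and is
   [1] on the other row. *)
case=> [[<- -> ->]|[<- -> ->]|[-> -> c12]|[-> -> d12]].
- exists 0, (2 * s k - 1), (1 - s k); cbv beta zeta; rewrite !sE sS sSS.
  by case: (s01 k) => ->; split; lra.
(* Here, and in the next case for [c = 1], the functional vanishes at both ends of the edge between
   consecutive vertices and is 2 at the remaining end. *)
- exists 1, (1 - 2 * s k), (- k%:R - 1 + s k); cbv beta zeta; rewrite !sE sS sSS !natrD.
  by case: (s01 k) => ->; split; lra.
- case: c12 => ->.
    exists (-1), (1 - 2 * s k), (k%:R + 1 + s k); cbv beta zeta.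
    rewrite !sE ?sSS ?sS ?sS1 !natrD -[k.+1%:R]natr1.
    by case: (s01 k) => ->; split; lra.
  exists 0, (1 - 2 * s k), (s k); cbv beta zeta; rewrite !sE !sSS sS1.
  by case: (s01 k) => ->; split; lra.
- case: d12 => ->; exists 0, (2 * s l - 1), (1 - s l); cbv beta zeta; rewrite !sE ?sSS ?sS ?sS1.
    by case: (s01 l) => ->; split; lra.
  by case: (s01 l) => ->; split; lra.
Qed.

Definition position (i : nat) : R * R :=
  if (i < 39)%N then pt (site_of i) else strip_pt (i - 39)%N.

(** The even length of the strip enters here: it puts [n - 2] at the upper and [n - 1] at the lower
    right corner. *)
Lemma strip_site j : j \in [:: 39; 40; n - 2; n - 1]%N ->
  strip_pt (j - 39)%N = pt (site_of (site_index n j)).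
Proof.
have zE (k : nat) : zr (Z.of_nat k) = k%:R := zr_nat k.
have p0 : (3 * m + 2)%:R != 0 :> R by rewrite pnatr_eq0 addn2.
have nE : n = (6 * m + 45)%N by [].
rewrite !inE => /or4P[]/eqP->.
- have -> : site_index n 39 = 39%N by rewrite /site_index !ifN_eqC; lia.
  by rewrite /strip_pt /pt /= mulr0 mul0r (zE 0) (zE 1).
- have -> : site_index n 40 = 40%N by rewrite /site_index !ifN_eqC; lia.
  by rewrite /strip_pt /pt /= mulr0 mul0r (zE 0).
- have -> : site_index n (n - 2) = 41%N by rewrite /site_index eqxx.
  have -> : (n - 2 - 39 = (3 * m + 2).*2)%N by rewrite nE; lia.
  by rewrite /strip_pt odd_double doubleK mulfK // /pt /= (zE 10) (zE 1).
- have -> : site_index n (n - 1) = 42%N by rewrite /site_index ifN_eqC ?eqxx; lia.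
  have -> : (n - 1 - 39 = (3 * m + 2).*2.+1)%N by rewrite nE; lia.
  by rewrite /strip_pt /= odd_double uphalf_double mulfK // /pt /= (zE 10) (zE 0).
Qed.

Lemma strip_pt_in_strip k : (k + 39 < n)%N -> in_strip (strip_pt k).
Proof.
move=> kn; have p0 : 0 < (3 * m + 2)%:R :> R by rewrite ltr0n addn2.
split; rewrite /strip_pt /=; try by case: (odd k).
rewrite ler_pdivrMr // ler_pM2l ?ltr0n // ler_nat.
by move: kn; rewrite /n /ring_order; lia.
Qed.

Lemma strip_pt_inj : injective strip_pt.
Proof.
have [a [b [c E]]] := strip_affine 1 0 0.
move=> k l kl; have := E k; rewrite kl E !mul1r !mul0r !addr0 => /eqP.
by rewrite eqr_nat => /eqP ->.
Qed.

Lemma position_inj i j : (i < n)%N -> (j < n)%N -> position i = position j -> i = j.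
Proof.
have high k l : (k < 39)%N -> pt (site_of k) <> strip_pt l.
  move=> k39 /(congr1 snd) /= e.
  have z1 : Z.ltb 0 (Z.add (site_of k).2 (Z.opp (Z.of_nat 1))).
    by have := site_hub_high k39; lia.
  by move: (zr_gt0 z1); rewrite zrD zrN zr_nat e; case: (odd l) => /=; rewrite ?mulr1n ?mulr0n; lra.
move=> im jm; rewrite /position.
have [i39|i39] := ltnP i 39; have [j39|j39] := ltnP j 39.
- move=> [/zr_inj e1 /zr_inj e2]; apply/eqP.
  rewrite -(nth_uniq (0, 0)%BZ _ _ uniq_site) ?(ltn_trans i39) ?(ltn_trans j39) //.
  by apply/eqP; rewrite -!/(site_of _) (surjective_pairing (site_of i)) e1 e2 -surjective_pairing.
- by move/high => /(_ i39).
- by move/esym/high => /(_ j39).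
- by move/strip_pt_inj; lia.
Qed.

(** An edge with an end below 39 meets the strip at most in a corner. Two such edges are covered by
    the integer check, mixed pairs by [above_strip], and pairs inside the strip by
    [strip_separated]. *)
Lemma edges_separated i j k l :
  (i < j)%N -> (j < n)%N -> fwd n i j -> (k < l)%N -> (l < n)%N -> fwd n k l ->
  (i, j) != (k, l) ->
  separated (position i) (position j) (position k) (position l).
Proof.
move=> ij jn fij kl ln fkl ijkl.
have n43 : (43 < n)%N by rewrite /n /ring_order; lia.
have hubP a b : (a < 39)%N -> (a < b)%N -> fwd n a b ->
    [/\ (a, site_index n b) \in site_edges,
        (39 <= b)%N -> b \in [:: 39; 40; n - 2; n - 1]%N,
        position a = pt (site_of a) & position b = pt (site_of (site_index n b))].
  move=> a39 ab fab; have [E B] := site_edge_fwd n43 a39 ab fab.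
  split => //; first by rewrite /position a39.
  rewrite /position; case: ltnP => [b39|/B/strip_site//].
  by rewrite /site_index !ifN_eqC //; lia.
have stripP a b : (39 <= a)%N -> (a < b)%N -> (b < n)%N -> fwd n a b ->
    [/\ position a = strip_pt (a - 39)%N, position b = strip_pt (b - 39)%N,
        in_strip (position a), in_strip (position b) & position a <> position b].
  move=> a39 ab bn _; have b39 := leq_trans a39 (ltnW ab).
  have e c : (39 <= c)%N -> position c = strip_pt (c - 39)%N.
    by move=> c39; rewrite /position ltnNge c39.
  rewrite !e //; split => //; try by apply: strip_pt_in_strip; lia.
  by move/strip_pt_inj; lia.
have [i39|i39] := ltnP i 39; have [k39|k39] := ltnP k 39.
- have [E1 B1 -> ->] := hubP _ _ i39 ij fij; have [E2 B2 -> ->] := hubP _ _ k39 kl fkl.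
  have [|l' /separates_separated//] := site_edges_separated E1 E2.
  apply: contra ijkl => /eqP[-> /(site_index_inj n43 B1 B2) ->].
  by rewrite eqxx.
- have [E1 _ -> ->] := hubP _ _ i39 ij fij; have [_ _ uS vS uv] := stripP _ _ k39 kl ln fkl.
  have [a [b [a0 b0 ab]]] := site_edges_above_strip E1.
  by have [] := above_strip_separated a0 b0 ab uS vS uv.
- have [E1 _ -> ->] := hubP _ _ k39 kl fkl; have [_ _ uS vS uv] := stripP _ _ i39 ij jn fij.
  have [a [b [a0 b0 ab]]] := site_edges_above_strip E1.
  by have [] := above_strip_separated a0 b0 ab uS vS uv.
have [-> -> _ _ _] := stripP _ _ i39 ij jn fij; have [-> -> _ _ _] := stripP _ _ k39 kl ln fkl.
move: fij fkl; rewrite !fwd_strip // => ji lk.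
have -> : (j - 39 = i - 39 + (j - i))%N by lia.
have -> : (l - 39 = k - 39 + (l - k))%N by lia.
apply: strip_separated; try lia.
by apply: contra ijkl; rewrite !xpair_eqE; lia.
Qed.

Definition straight_arc (e : {set 'I_n}) : R -> R * R :=
  if ends e is Some (i, j) then segment (position i) (position j) else fun=> 0.

Lemma ring_planar : planar R (ring_graph m).
Proof.
exists (fun i : ring_graph m => position i), straight_arc.
have disj : {in edges (ring_graph m) &, forall e f, e != f ->
    straight_arc e @` `]0, 1[ `&` straight_arc f @` `[0, 1] = set0}.
  move=> e f /endsP[i [j [ij fij eE eij]]] /endsP[k [l [kl fkl fE fkl']]] ef.
  rewrite /straight_arc eij fkl'; apply/separated_disjoint/edges_separated => //.
  by apply: contra ef; rewrite eE fE => /eqP[/val_inj-> /val_inj->].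
split => //.
- by move=> i j /position_inj; rewrite !ltn_ord => /(_ isT isT)/val_inj.
- move=> e /endsP[i [j [ij fij eE eij]]]; rewrite /straight_arc eij.
  have pij : position i <> position j.
    by move/position_inj; rewrite !ltn_ord => /(_ isT isT) E; rewrite E ltnn in ij.
  split.
  + exact/continuous_subspaceT/segment_continuous.
  + by move=> t u _ _; apply: segment_inj.
  + by exists i, j; rewrite segment0 segment1.
- move=> e eE z ez; have [f fE /andP[fe zf]] := other_edge e z.
  have ef : e != f by rewrite eq_sym.
  have : (straight_arc e @` `]0, 1[ `&` straight_arc f @` `[0, 1]) (position z).
    split => //; have [i [j [ij fij fij' fE']]] := endsP fE.
    rewrite /straight_arc fE'; move: zf; rewrite fij' !inE => /orP[]/eqP->.
      by exists 0; rewrite ?segment0 //= in_itv /= lexx ler01.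
    by exists 1; rewrite ?segment1 //= in_itv /= lexx ler01.
  by rewrite disj.
Qed.

End Positions.

End Drawing.

Theorem theorem2p1 (R : realType) :
  exists G : nat -> sgraph,
    (forall i j : nat, i <> j -> ~ isomorphic (G i) (G j)) /\
    (forall i : nat,
       planar R (G i) /\
       vertex_connected 4 (G i) /\
       essentially_edge_connected 6 (G i) /\
       regular 4 (G i) /\
       3 %| #|edges (G i)| /\
       ~ (exists P : {set {set {set G i}}}, claw_decomposition P)).
Proof.
exists ring_graph; split=> [i j ij /ring_graph_inj|i]; first exact: ij.
split; first exact: ring_planar.
split; first exact: ring_vertex_connected.
split; first exact: ring_essentially_edge_connected.
split; first exact: ring_graph_regular.
by split; [exact: ring_edges_mod3 | exact: ring_no_claw_decomposition].
Qed.
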